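(* Consider the smart-meter system with no battery ($B_{\max}=0$), an i.i.d. input load with distribution $p_X$, and renewable energy that is i.i.d. with distribution $p_E$ and not known to the utility provider. Let $\mathcal{I}^i(0)=\inf_{f\in\mathcal F}\limsup_{n\to\infty}\frac1n I(X^n;Y^n)$ be the optimal information leakage rate over all feasible energy management policies. Then $$\mathcal{I}^i(0)=\inf\Big\{ I(X;Y)\;:\; p_{Y|X}(y|x)=\sum_{e\in\mathcal E}p_E(e)\,p_{Y|X,E}(y|x,e),\ p_{Y|X,E}\in\mathcal P^i\Big\},$$ where $\mathcal P^i=\{p_{Y|X,E}: p_{Y|X,E}(y|x,e)=0 \text{ if } y>x \text{ or } y<x-e\}$ and $I(X;Y)$ is computed under the joint distribution $p_X(x)p_{Y|X}(y|x)$.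
   Context: Alphabets: $\mathcal X=\mathcal Y=\{0,1,\dots,X_{\max}\}$, $\mathcal E=\{0,1,\dots,E_{\max}\}$. The input load $(X_t)_{t\ge1}$ is i.i.d. with distribution $p_X$ on $\mathcal X$; the renewable energy $(E_t)_{t\ge 1}$ is i.i.d. with distribution $p_E$ on $\mathcal E$; the two sequences are independent. $X^n=(X_1,\dots,X_n)$, and similarly for the other sequences. $I(\cdot\,;\cdot)$ is mutual information. A (possibly randomized) causal energy management policy $f=(f_t)_{t\ge1}$ selects, at each time $t$, the output load $Y_t\in\mathcal Y$ according to a conditional distribution given $(X^t,E^t,Y^{t-1})$; the pairs $(X_s,E_s)$, $s>t$, are independent of everything up to and including time $t$. With no battery, the policy is feasible ($f\in\mathcal F$) if almost surely $0\le X_t-Y_t\le E_t$ for all $t$ (no further peak power constraint is imposed). *)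

(* Defs.v *)
From mathcomp Require Import all_boot all_order all_algebra.
From mathcomp Require Import all_classical all_reals all_analysis.

Set Implicit Arguments.
Unset Strict Implicit.
Unset Printing Implicit Defensive.

Import Order.TTheory GRing.Theory Num.Theory.

Local Open Scope classical_set_scope.
Local Open Scope ring_scope.

Record fdist (R : realType) (A : finType) := FDist {
  fdist_fun :> A -> R;
  fdist_ge0 : forall a, 0 <= fdist_fun a;
  fdist_sum1 : \sum_a fdist_fun a = 1
}.

Definition log2 {R : realType} (x : R) : R := ln x / ln 2.

(* Mutual information, in bits, of the joint mass function [P]. The usual
   convention 0 log 0 = 0 holds because a term with [P a b = 0] has a zero
   factor; when [P a b > 0] both marginals are positive. *)
Definition mutual_info {R : realType} {A B : finType} (P : A -> B -> R) : R :=
  \sum_a \sum_b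
    P a b * log2 (P a b / ((\sum_b' P a b') * (\sum_a' P a' b))).

Definition prefix_of {T : Type} {k n : nat} (le_kn : (k <= n)%N)
    (u : {ffun 'I_n -> T}) : {ffun 'I_k -> T} :=
  [ffun i => u (widen_ord le_kn i)].

Section NoBattery.
Variables (R : realType) (Xmax Emax : nat).

Let X := 'I_Xmax.+1.
Let Y := 'I_Xmax.+1.
Let E := 'I_Emax.+1.

(* Time is indexed from 0: at time [t] the output load is drawn from a
   conditional distribution given the [t.+1] input loads and energies seen so
   far and the [t] previous output loads. *)
Definition policy : Type := forall t : nat,
  {ffun 'I_t.+1 -> X} -> {ffun 'I_t.+1 -> E} -> {ffun 'I_t -> Y} -> fdist R Y.

Variables (pX : fdist R X) (pE : fdist R E).

(* P(X^n = x, E^n = e, Y^n = y) by the chain rule: given the past up to time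
   t - 1, (X_t, E_t) has law pX * pE, and then Y_t is drawn from the policy. *)
Definition joint_law (f : policy) (n : nat) (x : {ffun 'I_n -> X})
    (e : {ffun 'I_n -> E}) (y : {ffun 'I_n -> Y}) : R :=
  \prod_(t < n)
    (pX (x t) * pE (e t) *
     f t (prefix_of (ltn_ord t) x) (prefix_of (ltn_ord t) e)
         (prefix_of (ltnW (ltn_ord t)) y) (y t)).

Definition load_law (f : policy) (n : nat) (x : {ffun 'I_n -> X})
    (y : {ffun 'I_n -> Y}) : R :=
  \sum_e joint_law f x e y.

(* 0 <= X_t - Y_t <= E_t; the first conjunct makes the subtraction on [nat]
   exact in the second. *)
Definition load_ok (x : X) (e : E) (y : Y) : bool :=
  (y <= x)%N && (x - y <= e)%N.

(* The alphabets being finite, the constraint holds almost surely at all times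
   iff it holds along every finite trajectory of positive probability. *)
Definition feasible : set policy :=
  [set f | forall (n : nat) (x : {ffun 'I_n -> X}) (e : {ffun 'I_n -> E})
             (y : {ffun 'I_n -> Y}),
     0 < joint_law f x e y -> forall t : 'I_n, load_ok (x t) (e t) (y t)].

(* The limit superior and the infimum are taken in the extended reals, where
   they always exist. *)
Definition leakage_rate (f : policy) : \bar R :=
  limn_esup (fun n => (mutual_info (@load_law f n) / n%:R)%:E).

Definition optimal_leakage_rate : \bar R :=
  ereal_inf [set leakage_rate f | f in feasible].

Definition Pi : set (X -> E -> fdist R Y) :=
  [set q | forall (x : X) (e : E) (y : Y),
     (x < y)%N || (y + e < x)%N -> q x e y = 0].

Definition channel (q : X -> E -> fdist R Y) (x : X) (y : Y) : R :=
  \sum_e pE e * q x e y.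

Definition single_letter_info (q : X -> E -> fdist R Y) : R :=
  mutual_info (fun x y => pX x * channel q x y).

End NoBattery.

Arguments Pi : clear implicits.

(* Main.v *)
(* Upper bound: using an admissible single-letter channel independently at each
   time makes (X_t, Y_t) i.i.d., so the leakage rate is exactly I(X;Y).

   Lower bound: since X^n has independent components, I(X^n;Y^n) minus
   sum_t I(X_t;Y_t) is the relative entropy of P(x^n,y^n) with respect to
   P(y^n) prod_t P(x_t|y_t), hence nonnegative by Gibbs' inequality. As
   (X_t,E_t) has law pX * pE, I(X_t;Y_t) is the single-letter information of
   the conditional law of Y_t given (X_t,E_t), which feasibility puts in P^i. *)
Require Import Defs.
From mathcomp Require Import all_boot all_order all_algebra.
From mathcomp Require Import all_classical all_reals all_analysis.
From mathcomp Require Import ring.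

Set Implicit Arguments.
Unset Strict Implicit.
Unset Printing Implicit Defensive.

Import Order.TTheory GRing.Theory Num.Theory.

Local Open Scope classical_set_scope.
Local Open Scope ring_scope.

(** * Logarithms and Gibbs' inequality *)

Section Information.
Variable R : realType.

Lemma ln2_gt0 : 0 < ln (2 : R).
Proof. by rewrite ln_gt0 // ltr1n. Qed.

Lemma log2M (x y : R) : 0 < x -> 0 < y -> log2 (x * y) = log2 x + log2 y.
Proof. by move=> x0 y0; rewrite /log2 lnM ?posrE // mulrDl. Qed.

Lemma log2_1 : log2 (1 : R) = 0.
Proof. by rewrite /log2 ln1 mul0r. Qed.

Lemma log2_prod (I : finType) (F : I -> R) :
  (forall i, 0 < F i) -> log2 (\prod_i F i) = \sum_i log2 (F i).
Proof.
move=> F0; suff [] : 0 < \prod_i F i /\ log2 (\prod_i F i) = \sum_i log2 (F i)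
  by [].
apply: (big_ind2 (fun a b : R => 0 < a /\ log2 a = b)) => //.
- by rewrite log2_1.
- by move=> a b c d [a0 <-] [c0 <-]; rewrite mulr_gt0 // log2M.
Qed.

(** For p > 0 this is exp u >= 1 + u at u = ln (q / p), multiplied by p; for p = 0 the left side is
    at most 0. *)
Lemma gibbs_pointwise (p q : R) : 0 <= p -> 0 <= q -> (0 < p -> 0 < q) ->
  (p - q) / ln 2 <= p * log2 (p / q).
Proof.
move=> p0 q0 pq; rewrite /log2 mulrA ler_pM2r ?invr_gt0 ?ln2_gt0 //.
move: p0; rewrite le_eqVlt => /predU1P[<-|p0];
  first by rewrite mul0r sub0r oppr_le0.
have q_gt0 := pq p0.
have := expR_ge1Dx (ln (q / p)); rewrite lnK ?posrE ?divr_gt0 //.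
have -> : ln (q / p) = - ln (p / q) by rewrite -lnV ?posrE ?divr_gt0 // invf_div.
move=> le_ln; rewrite -subr_ge0.
have -> : p * ln (p / q) - (p - q) = p * (q / p - (1 - ln (p / q))).
  by field; rewrite gt_eqF.
by rewrite mulr_ge0 ?(ltW p0) // subr_ge0.
Qed.

(** * Superadditivity of mutual information for independent inputs *)

Section Marginals.
Variables (I A B : finType) (P : {ffun I -> A} -> {ffun I -> B} -> R).

Definition marginal (t : I) (a : A) (b : B) : R :=
  \sum_(x : {ffun I -> A} | x t == a) \sum_(y : {ffun I -> B} | y t == b) P x y.

(** Lets each I(X_t;Y_t) be written as a sum over whole sequences, to be compared term by term with
    I(X^n;Y^n). *)
Lemma sum_marginal (t : I) (h : A -> B -> R) :
  \sum_x \sum_y P x y * h (x t) (y t) =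
  \sum_a \sum_b marginal t a b * h a b.
Proof.
rewrite (partition_big (fun x : {ffun I -> A} => x t) predT) //=.
apply: eq_bigr => a _; under [RHS]eq_bigr => b _ do rewrite /marginal mulr_suml.
rewrite [RHS]exchange_big /=; apply: eq_bigr => x /eqP xt.
rewrite (partition_big (fun y : {ffun I -> B} => y t) predT) //=.
apply: eq_bigr => b _; rewrite mulr_suml; apply: eq_bigr => y /eqP yt.
by rewrite xt yt.
Qed.

Hypothesis P_ge0 : forall x y, 0 <= P x y.

Lemma marginal_ge0 t a b : 0 <= marginal t a b.
Proof. by apply: sumr_ge0 => x _; apply: sumr_ge0. Qed.

Lemma le_marginal t x y : P x y <= marginal t (x t) (y t).
Proof.
rewrite /marginal (bigD1 x) //= (bigD1 y) //= -addrA lerDl addr_ge0 //.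
- by apply: sumr_ge0.
- by apply: sumr_ge0 => ? _; apply: sumr_ge0.
Qed.

(* P(y) prod_t P(x_t | y_t); where P(y_t) = 0 the factor is 0 / 0 = 0, so the
   total mass may a priori drop below 1. *)
Definition memoryless_backward (x : {ffun I -> A}) (y : {ffun I -> B}) : R :=
  (\sum_x' P x' y) *
  \prod_t (marginal t (x t) (y t) / \sum_a marginal t a (y t)).

Hypothesis indep_inputs :
  forall x, \sum_y P x y = \prod_t \sum_b marginal t (x t) b.

(** The identity holds term by term: where P(x,y) > 0 all marginals are positive and the logarithms
    merge into one. *)
Lemma mutual_info_chain :
  mutual_info P = \sum_t mutual_info (marginal t) +
    \sum_x \sum_y P x y * log2 (P x y / memoryless_backward x y).
Proof.
rewrite /mutual_info.
rewrite (eq_bigr (fun t => \sum_x \sum_y P x y *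
    log2 (marginal t (x t) (y t) / ((\sum_b marginal t (x t) b) *
      \sum_a marginal t a (y t))))) => [|t _]; last first.
  by rewrite (sum_marginal t (fun a b => log2 (marginal t a b /
    ((\sum_b' marginal t a b') * \sum_a' marginal t a' b)))).
rewrite [X in _ = X + _]exchange_big -big_split /=; apply: eq_bigr => x _.
rewrite [X in _ = X + _]exchange_big -big_split /=; apply: eq_bigr => y _.
have [->|Pn0] := eqVneq (P x y) 0.
  by rewrite !mul0r addr0 big1 // => t _; rewrite mul0r.
rewrite -mulr_sumr -mulrDr; congr (_ * _).
have P0 : 0 < P x y by rewrite lt_neqAle eq_sym Pn0 P_ge0.
have m0 t : 0 < marginal t (x t) (y t) := lt_le_trans P0 (le_marginal t x y).
have mX0 t : 0 < \sum_b marginal t (x t) b.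
  rewrite (bigD1 (y t)) //= ltr_wpDr ?m0 //.
  by apply: sumr_ge0 => *; apply: marginal_ge0.
have mY0 t : 0 < \sum_a marginal t a (y t).
  rewrite (bigD1 (x t)) //= ltr_wpDr ?m0 //.
  by apply: sumr_ge0 => *; apply: marginal_ge0.
have PY0 : 0 < \sum_x' P x' y.
  by rewrite (bigD1 x) //= ltr_wpDr // sumr_ge0.
rewrite -log2_prod => [|t]; last by rewrite divr_gt0 ?mulr_gt0.
rewrite -log2M; last 2 first.
- by apply: prodr_gt0 => t _; rewrite divr_gt0 ?mulr_gt0.
- rewrite divr_gt0 // /memoryless_backward mulr_gt0 //.
  by apply: prodr_gt0 => t _; rewrite divr_gt0.
(* Independence turns P(x) into the product of the P(x_t), which cancels the input marginals of the
   single-letter terms. *)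
congr log2; rewrite indep_inputs /memoryless_backward !prodf_div big_split /=.
have : 0 < \prod_t marginal t (x t) (y t) by apply: prodr_gt0.
have : 0 < \prod_t \sum_b marginal t (x t) b by apply: prodr_gt0.
have : 0 < \prod_t \sum_a marginal t a (y t) by apply: prodr_gt0.
move=> /lt0r_neq0 ? /lt0r_neq0 ? /lt0r_neq0 ?; move/lt0r_neq0 in PY0.
by field; apply/and4P.
Qed.

(** For fixed y the sum over x factors over t, and each factor is 1, or 0 where P(y_t) = 0. *)
Lemma sum_memoryless_backward :
  \sum_x \sum_y memoryless_backward x y <= \sum_x \sum_y P x y.
Proof.
rewrite exchange_big [leRHS]exchange_big /=; apply: ler_sum => y _.
rewrite /memoryless_backward -mulr_sumr -[leRHS]mulr1 ler_wpM2l ?sumr_ge0 //.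
rewrite -(bigA_distr_bigA (fun t a =>
  marginal t a (y t) / \sum_a' marginal t a' (y t))) /=.
apply: prodr_ile1 => t _; rewrite -mulr_suml.
have [->|n0] := eqVneq (\sum_a marginal t a (y t)) 0.
  by rewrite mul0r ler01 lexx.
by rewrite divff // ler01 lexx.
Qed.

Lemma mutual_info_superadditive :
  \sum_t mutual_info (marginal t) <= mutual_info P.
Proof.
rewrite mutual_info_chain lerDl.
have Q_ge0 x y : 0 <= memoryless_backward x y.
  rewrite mulr_ge0 ?sumr_ge0 // prodr_ge0 // => t _.
  by rewrite divr_ge0 ?marginal_ge0 ?sumr_ge0 // => a _; apply: marginal_ge0.
(* Gibbs' bound is summed over all pairs; the intermediate sum is nonnegative because the backward
   law has no more mass than P. *)
apply: (@le_trans _ _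
  (\sum_x \sum_y (P x y - memoryless_backward x y) / ln 2)).
  under eq_bigr => x _ do rewrite -mulr_suml.
  rewrite -mulr_suml divr_ge0 ?(ltW ln2_gt0) //.
  under eq_bigr => x _ do rewrite sumrB.
  by rewrite sumrB subr_ge0 sum_memoryless_backward.
apply: ler_sum => x _; apply: ler_sum => y _; apply: gibbs_pointwise => // P0.
rewrite mulr_gt0 //; first by rewrite (bigD1 x) //= ltr_wpDr // sumr_ge0.
apply: prodr_gt0 => t _.
have m0 : 0 < marginal t (x t) (y t) := lt_le_trans P0 (le_marginal t x y).
rewrite divr_gt0 // (bigD1 (x t)) //= ltr_wpDr //.
by apply: sumr_ge0 => *; apply: marginal_ge0.
Qed.

End Marginals.

(** The constraint x t = a becomes an indicator inside factor t, so the sum runs over all functions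
    and distributes over the product. *)
Lemma sum_prod_at (I A : finType) (F : I -> A -> R) (t : I) (a : A) :
  \sum_(x : {ffun I -> A} | x t == a) \prod_s F s (x s) =
  F t a * \prod_(s | s != t) \sum_b F s b.
Proof.
transitivity (\sum_(x : {ffun I -> A})
    \prod_s (F s (x s) * ((s == t) ==> (x s == a))%:R)).
  rewrite big_mkcond; apply: eq_bigr => x _; rewrite big_split /=.
  rewrite [X in _ = _ * X](bigD1 t) //= eqxx /= [X in _ = _ * (_ * X)]big1.
    by case: eqP => _; rewrite ?mulr1 ?mulr0.
  by move=> s /negPf ->.
rewrite -(bigA_distr_bigA (fun s b => F s b * ((s == t) ==> (b == a))%:R)) /=.
rewrite (bigD1 t) //=; congr (_ * _).
  rewrite (bigD1 a) //= !eqxx mulr1 big1 ?addr0 // => b /negPf ->.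
  by rewrite mulr0.
by apply: eq_bigr => s /negPf ->; apply: eq_bigr => b _; rewrite mulr1.
Qed.

(** * Mutual information of a product law *)

Section Memoryless.
Variables (I A B : finType) (W : A -> B -> R).
Hypothesis W_ge0 : forall a b, 0 <= W a b.
Hypothesis W_sum1 : \sum_a \sum_b W a b = 1.

Let P (x : {ffun I -> A}) (y : {ffun I -> B}) := \prod_t W (x t) (y t).

Lemma marginal_memoryless t : marginal P t = W.
Proof.
apply/funext => a; apply/funext => b; rewrite /marginal.
under eq_bigr => x _ do rewrite (sum_prod_at (fun s b => W (x s) b)).
(* With the special factor at t absorbed into a single product, [sum_prod_at] applies again, now to
   the inputs. *)
transitivity (\sum_(x : {ffun I -> A} | x t == a)
    \prod_s (if s == t then W (x s) b else \sum_b' W (x s) b')).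
  apply: eq_bigr => x _; rewrite [RHS](bigD1 t) //= eqxx; congr (_ * _).
  by apply: eq_bigr => s /negPf ->.
rewrite (sum_prod_at (fun s a => if s == t then W a b else \sum_b' W a b')).
rewrite eqxx big1 ?mulr1 // => s /negPf st.
by under eq_bigr => a' _ do rewrite st.
Qed.

Lemma mutual_info_memoryless : mutual_info P = #|I|%:R * mutual_info W.
Proof.
have P_ge0 x y : 0 <= P x y by apply: prodr_ge0.
rewrite mutual_info_chain // => [|x]; last first.
  under [RHS]eq_bigr => t _ do rewrite marginal_memoryless.
  by rewrite bigA_distr_bigA.
under eq_bigr => t _ do rewrite marginal_memoryless.
rewrite sumr_const -[_ *+ #|_|]mulr_natl.
rewrite big1 ?addr0 // => x _; rewrite big1 // => y _.
have [->|P0] := eqVneq (P x y) 0; first by rewrite mul0r.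
(* For a product law the backward law is P itself, so the relative entropy term vanishes. *)
rewrite (_ : memoryless_backward P x y = P x y) ?divff ?log2_1 ?mulr0 //.
rewrite /memoryless_backward.
under eq_bigr => t _ do rewrite marginal_memoryless.
rewrite prodf_div -/(P x y) mulrCA bigA_distr_bigA /= divff ?mulr1 //.
by rewrite gt_eqF // (bigD1 x) //= ltr_wpDr ?sumr_ge0 // lt_neqAle eq_sym P0 P_ge0.
Qed.

End Memoryless.
End Information.

(** * Trajectory laws of causal policies *)

Section Causal.
Variables (R : realType) (Xmax Emax : nat).
Variables (pX : fdist R 'I_Xmax.+1) (pE : fdist R 'I_Emax.+1).
Implicit Types (f : policy R Xmax Emax)
  (q : 'I_Xmax.+1 -> 'I_Emax.+1 -> fdist R 'I_Xmax.+1).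

Lemma joint_law_ge0 f n (x : {ffun 'I_n -> 'I_Xmax.+1})
    (e : {ffun 'I_n -> 'I_Emax.+1}) (y : {ffun 'I_n -> 'I_Xmax.+1}) :
  0 <= joint_law pX pE f x e y.
Proof. by apply: prodr_ge0 => t _; rewrite !mulr_ge0 ?fdist_ge0. Qed.

Lemma prefix_of_id (T : Type) n (le_nn : (n <= n)%N) (u : {ffun 'I_n -> T}) :
  prefix_of le_nn u = u.
Proof. by apply/ffunP => i; rewrite ffunE; congr (u _); apply: val_inj. Qed.

Lemma prefix_of_comp (T : Type) k m n (le_km : (k <= m)%N) (le_mn : (m <= n)%N)
    (le_kn : (k <= n)%N) (u : {ffun 'I_n -> T}) :
  prefix_of le_km (prefix_of le_mn u) = prefix_of le_kn u.
Proof. by apply/ffunP => i; rewrite !ffunE; congr (u _); apply: val_inj. Qed.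

Lemma joint_lawS f n (x : {ffun 'I_n.+1 -> 'I_Xmax.+1})
    (e : {ffun 'I_n.+1 -> 'I_Emax.+1}) (y : {ffun 'I_n.+1 -> 'I_Xmax.+1}) :
  joint_law pX pE f x e y =
  joint_law pX pE f (prefix_of (leqnSn n) x) (prefix_of (leqnSn n) e)
    (prefix_of (leqnSn n) y) *
  (pX (x ord_max) * pE (e ord_max) *
   f n x e (prefix_of (leqnSn n) y) (y ord_max)).
Proof.
rewrite {1}/joint_law big_ord_recr /= !prefix_of_id; congr (_ * _).
  apply: eq_bigr => i _.
  rewrite !(prefix_of_comp _ _ (ltn_ord (widen_ord (leqnSn n) i))).
  by rewrite (prefix_of_comp _ _ (ltnW (ltn_ord (widen_ord (leqnSn n) i)))) !ffunE.
congr (_ * f n x e _ _); apply/ffunP => i; rewrite !ffunE.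
by congr (y _); apply: val_inj.
Qed.

(** Inverse of splitting off the last entry; [unlift ord_max] is [None] exactly at the last
    index. *)
Definition snoc (T : Type) n (u : {ffun 'I_n -> T}) (b : T) : {ffun 'I_n.+1 -> T} :=
  [ffun i => if unlift ord_max i is Some j then u j else b].

Lemma prefix_of_snoc (T : Type) n (u : {ffun 'I_n -> T}) b :
  prefix_of (leqnSn n) (snoc u b) = u.
Proof.
apply/ffunP => i; rewrite !ffunE.
have -> : widen_ord (leqnSn n) i = lift ord_max i.
  by apply: val_inj; rewrite /= /bump leqNgt ltn_ord.
by rewrite liftK.
Qed.

Lemma snoc_last (T : Type) n (u : {ffun 'I_n -> T}) b : snoc u b ord_max = b.
Proof. by rewrite ffunE unlift_none. Qed.

Lemma prefix_ofK (T : Type) n (v : {ffun 'I_n.+1 -> T}) :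
  snoc (prefix_of (leqnSn n) v) (v ord_max) = v.
Proof.
apply/ffunP => i; rewrite ffunE; case: unliftP => [j ->|-> //].
rewrite ffunE; congr (v _); apply: val_inj.
by rewrite /= /bump leqNgt ltn_ord.
Qed.

Lemma sum_snoc (T : finType) n (F : {ffun 'I_n.+1 -> T} -> R) :
  \sum_v F v = \sum_u \sum_b F (snoc u b).
Proof.
rewrite pair_big /= (reindex (fun p : {ffun 'I_n -> T} * T => snoc p.1 p.2)) //.
exists (fun v => (prefix_of (leqnSn n) v, v ord_max)) => [[u b]|v] _ /=.
  by rewrite prefix_of_snoc snoc_last.
exact: prefix_ofK.
Qed.

(** Causality enters here: the last output occurs only in the last factor, so it sums to 1 first,
    and induction removes the others. *)
Lemma sum_joint_law_output f n (x : {ffun 'I_n -> 'I_Xmax.+1})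
    (e : {ffun 'I_n -> 'I_Emax.+1}) :
  \sum_y joint_law pX pE f x e y = \prod_t (pX (x t) * pE (e t)).
Proof.
elim: n x e => [|n IHn] x e.
  rewrite [RHS]big_ord0 (eq_bigr (fun=> 1)) => [|y _]; last exact: big_ord0.
  by rewrite sumr_const card_ffun !card_ord expn0.
rewrite sum_snoc big_ord_recr /=.
under eq_bigr => u _ do
  (under eq_bigr => b _ do rewrite joint_lawS prefix_of_snoc snoc_last;
   rewrite -!mulr_sumr fdist_sum1 mulr1).
rewrite -mulr_suml IHn; congr (_ * _).
by apply: eq_bigr => t _; rewrite !ffunE.
Qed.

(** * The law of (X_t, E_t, Y_t) and the conditional law of Y_t given (X_t, E_t) *)

Definition stage_law f n (t : 'I_n) a e b : R :=
  \sum_(x : {ffun 'I_n -> 'I_Xmax.+1} | x t == a)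
  \sum_(u : {ffun 'I_n -> 'I_Emax.+1} | u t == e)
  \sum_(y : {ffun 'I_n -> 'I_Xmax.+1} | y t == b) joint_law pX pE f x u y.

Lemma stage_law_ge0 f n (t : 'I_n) a e b : 0 <= stage_law f t a e b.
Proof.
by do 3! (apply: sumr_ge0 => ? _); apply: joint_law_ge0.
Qed.

Lemma sum_stage_law_output f n (t : 'I_n) a e :
  \sum_b stage_law f t a e b = pX a * pE e.
Proof.
rewrite exchange_big /=.
transitivity (\sum_(x : {ffun 'I_n -> 'I_Xmax.+1} | x t == a)
    (\prod_s pX (x s)) * pE e).
  apply: eq_bigr => x _; rewrite exchange_big /=.
  rewrite (eq_bigr (fun u : {ffun 'I_n -> 'I_Emax.+1} =>
      \prod_s (pX (x s) * pE (u s)))) => [|u _]; last first.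
    rewrite -(sum_joint_law_output f).
    by rewrite [RHS](partition_big (fun y : {ffun 'I_n -> 'I_Xmax.+1} => y t) predT).
  under eq_bigr => u _ do rewrite big_split /=.
  rewrite -mulr_sumr (sum_prod_at (fun _ c => pE c)).
  by rewrite [X in _ * (_ * X)]big1 ?mulr1 // => s _; rewrite fdist_sum1.
rewrite -mulr_suml (sum_prod_at (fun _ c => pX c)).
by rewrite [X in _ * X * _]big1 ?mulr1 // => s _; rewrite fdist_sum1.
Qed.

Lemma marginal_load_law f n (t : 'I_n) a b :
  marginal (@load_law R Xmax Emax pX pE f n) t a b = \sum_e stage_law f t a e b.
Proof.
rewrite /marginal [RHS]exchange_big /=; apply: eq_bigr => x _.
rewrite /load_law exchange_big /=.
by rewrite (partition_big (fun u : {ffun 'I_n -> 'I_Emax.+1} => u t) predT).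
Qed.

Lemma sum_load_law_output f n (x : {ffun 'I_n -> 'I_Xmax.+1}) :
  \sum_y load_law pX pE f x y = \prod_t pX (x t).
Proof.
rewrite exchange_big /=.
under eq_bigr => e _ do rewrite sum_joint_law_output big_split.
rewrite -mulr_sumr -(bigA_distr_bigA (fun _ c => pE c)) /= [X in _ * X]big1 ?mulr1 // => s _.
exact: fdist_sum1.
Qed.

(** Under any causal policy the inputs keep their i.i.d. law, which supplies the independence needed
    for superadditivity. *)
Lemma load_law_superadditive f n :
  \sum_(t < n) mutual_info (marginal (@load_law R Xmax Emax pX pE f n) t) <=
  mutual_info (@load_law R Xmax Emax pX pE f n).
Proof.
apply: mutual_info_superadditive => [x y|x].
  by apply: sumr_ge0 => *; apply: joint_law_ge0.
rewrite sum_load_law_output; apply: eq_bigr => t _.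
under eq_bigr => b _ do rewrite marginal_load_law.
rewrite exchange_big /=; under eq_bigr => e _ do rewrite sum_stage_law_output.
by rewrite -mulr_sumr fdist_sum1 mulr1.
Qed.

Lemma dirac_sum1 (T : finType) (a : T) : \sum_b (b == a)%:R = 1 :> R.
Proof. by rewrite (bigD1 a) //= eqxx big1 ?addr0 // => b /negPf ->. Qed.

Definition dirac_fdist (T : finType) (a : T) : fdist R T :=
  FDist (fun b => ler0n R (b == a)) (dirac_sum1 a).

(* On null pairs (a, e) the conditional law is undefined; y = x is always
   admissible, since then no renewable energy is used. *)
Definition stage_channel_fun f n (t : 'I_n) a e b : R :=
  if pX a * pE e == 0 then dirac_fdist a b
  else stage_law f t a e b / (pX a * pE e).

Lemma stage_channel_ge0 f n (t : 'I_n) a e b : 0 <= stage_channel_fun f t a e b.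
Proof.
rewrite /stage_channel_fun; case: eqP => _; first exact: fdist_ge0.
by rewrite divr_ge0 ?stage_law_ge0 ?mulr_ge0 ?fdist_ge0.
Qed.

Lemma stage_channel_sum1 f n (t : 'I_n) a e : \sum_b stage_channel_fun f t a e b = 1.
Proof.
rewrite /stage_channel_fun; case: eqP => [_|/eqP n0]; first exact: fdist_sum1.
by rewrite -mulr_suml sum_stage_law_output divff.
Qed.

Definition stage_channel f n (t : 'I_n) a e : fdist R 'I_Xmax.+1 :=
  FDist (stage_channel_ge0 f t a e) (stage_channel_sum1 f t a e).

Lemma stage_channelE f n (t : 'I_n) a e b :
  pX a * pE e * stage_channel f t a e b = stage_law f t a e b.
Proof.
rewrite /= /stage_channel_fun; case: eqP => [p0|/eqP n0].
  (* On a null pair the stage law is squeezed between 0 and its sum over outputs, which is 0. *)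
  rewrite p0 mul0r; apply/esym/eqP; rewrite eq_le stage_law_ge0 andbT -p0.
  rewrite -(sum_stage_law_output f t) (bigD1 b) //= lerDl.
  by apply: sumr_ge0 => *; apply: stage_law_ge0.
by rewrite mulrC divfK.
Qed.

(** Since X_t and E_t are independent, averaging the stage channel over [pE] recovers the law of
    (X_t, Y_t). *)
Lemma single_letter_info_stage f n (t : 'I_n) :
  single_letter_info pX pE (stage_channel f t) =
  mutual_info (marginal (@load_law R Xmax Emax pX pE f n) t).
Proof.
congr mutual_info; apply/funext => a; apply/funext => b.
rewrite marginal_load_law /channel mulr_sumr; apply: eq_bigr => e _.
by rewrite mulrA stage_channelE.
Qed.

Lemma stage_channel_Pi f n (t : 'I_n) :
  feasible pX pE f -> Pi R Xmax Emax (stage_channel f t).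
Proof.
move=> feas a e b bad; rewrite /= /stage_channel_fun; case: eqP => [_|_] /=.
  by case: eqP bad => // ->; rewrite ltnn ltnNge leq_addr.
rewrite (_ : stage_law _ _ _ _ _ = 0) ?mul0r //.
(* Every trajectory through an inadmissible triple has probability 0 by feasibility. *)
rewrite /stage_law big1 // => x /eqP xt; rewrite big1 // => u /eqP ut.
rewrite big1 // => y /eqP yt; apply/eqP; rewrite eq_le joint_law_ge0 andbT.
rewrite leNgt; apply/negP => /feas /(_ t); rewrite /load_ok xt ut yt.
move=> /andP[ba abe]; move: bad; rewrite ltnNge ba /= ltnNge.
by rewrite -leq_subLR abe.
Qed.

(** * Policies that apply a single-letter channel to the current load and energy *)

Definition memoryless_policy q : policy R Xmax Emax :=
  fun t x e _ => q (x ord_max) (e ord_max).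

Lemma joint_law_memoryless q n (x : {ffun 'I_n -> 'I_Xmax.+1})
    (e : {ffun 'I_n -> 'I_Emax.+1}) (y : {ffun 'I_n -> 'I_Xmax.+1}) :
  joint_law pX pE (memoryless_policy q) x e y =
  \prod_t (pX (x t) * pE (e t) * q (x t) (e t) (y t)).
Proof.
apply: eq_bigr => t _; rewrite /memoryless_policy !ffunE.
by have -> : widen_ord (ltn_ord t) ord_max = t by apply: val_inj.
Qed.

Lemma load_law_memoryless q n :
  @load_law R Xmax Emax pX pE (memoryless_policy q) n =
  fun x y => \prod_t (pX (x t) * channel pE q (x t) (y t)).
Proof.
apply/funext => x; apply/funext => y; rewrite /load_law /channel.
under [LHS]eq_bigr => e _ do rewrite joint_law_memoryless.
rewrite -(bigA_distr_bigA (fun t c => pX (x t) * pE c * q (x t) c (y t))) /=.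
apply: eq_bigr => t _; rewrite mulr_sumr.
by apply: eq_bigr => c _; rewrite mulrA.
Qed.

Lemma mutual_info_memoryless_policy q n :
  mutual_info (@load_law R Xmax Emax pX pE (memoryless_policy q) n) =
  n%:R * single_letter_info pX pE q.
Proof.
rewrite load_law_memoryless.
rewrite (@mutual_info_memoryless _ _ _ _ (fun a b => pX a * channel pE q a b))
  ?card_ord // => [a b|].
  rewrite mulr_ge0 ?fdist_ge0 // sumr_ge0 // => c _.
  by rewrite mulr_ge0 ?fdist_ge0.
rewrite -[RHS](fdist_sum1 pX); apply: eq_bigr => a _.
rewrite -mulr_sumr exchange_big /= -[RHS]mulr1; congr (_ * _).
under eq_bigr => c _ do rewrite -mulr_sumr fdist_sum1 mulr1.
exact: fdist_sum1.
Qed.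

Lemma memoryless_policy_feasible q :
  Pi R Xmax Emax q -> feasible pX pE (memoryless_policy q).
Proof.
move=> qPi n x e y; rewrite joint_law_memoryless => pos t.
move: pos; rewrite (bigD1 t) //= /load_ok.
have [|] := boolP ((x t < y t)%N || (y t + e t < x t)%N).
  by move=> /qPi ->; rewrite mulr0 mul0r ltxx.
by rewrite negb_or -!leqNgt leq_subLR addnC [(e t + _)%N]addnC.
Qed.

(** * The two bounds on the leakage rate *)

Lemma leakage_rate_memoryless q :
  (leakage_rate pX pE (memoryless_policy q) <= (single_letter_info pX pE q)%:E)%E.
Proof.
apply: ge_ereal_inf; eexists.
  (* The limit superior is an infimum of suprema over neighbourhoods of infinity; n > 0 is chosen
     because the normalized information is constant there. *)
  by exists [set n | (0 < n)%N] => //; apply: nbhs_infty_gt.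
apply: ge_ereal_sup => _ [n n0 <-].
by rewrite mutual_info_memoryless_policy mulrAC divff ?mul1r // pnatr_eq0 -lt0n.
Qed.

Lemma leakage_rate_ge f : feasible pX pE f ->
  (ereal_inf [set (single_letter_info pX pE q)%:E | q in Pi R Xmax Emax] <=
   leakage_rate pX pE f)%E.
Proof.
move=> feas; apply/ereal_infP => _ [V [N _ NV] <-].
(* One index of the neighbourhood suffices: N + 1 lies in it and is nonzero, so division by it is
   legitimate. *)
apply: (@le_trans _ _
  (mutual_info (@load_law R Xmax Emax pX pE f N.+1) / N.+1%:R)%:E); last first.
  by apply: ereal_sup_ubound; exists N.+1 => //; apply: NV => /=.
set c := ereal_inf _.
have c_le (t : 'I_N.+1) :
    (c <= (mutual_info (marginal (@load_law R Xmax Emax pX pE f N.+1) t))%:E)%E.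
  rewrite -single_letter_info_stage; apply: ereal_inf_lbound.
  by exists (stage_channel f t) => //; apply: stage_channel_Pi.
(* For finite c = r, the N + 1 single-letter terms sum to at least (N + 1) r; c = +oo is impossible,
   as stage 0 has finite information. *)
case: c c_le => [r||] c_le; last by rewrite leNye.
  rewrite lee_fin ler_pdivlMr ?ltr0n //.
  apply: le_trans (load_law_superadditive f N.+1).
  rewrite mulr_natr -[X in _ *+ X]card_ord -sumr_const.
  by apply: ler_sum => t _; rewrite -lee_fin.
by have := c_le ord0; rewrite leye_eq.
Qed.

End Causal.

Theorem theorem4 (R : realType) (Xmax Emax : nat)
    (pX : fdist R 'I_Xmax.+1) (pE : fdist R 'I_Emax.+1) :
  optimal_leakage_rate pX pE =
  ereal_inf [set (single_letter_info pX pE q)%:E | q in Pi R Xmax Emax].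
Proof.
apply/eqP; rewrite eq_le; apply/andP; split; apply/ereal_infP => _ [g gP <-].
  apply: ge_ereal_inf; exists (leakage_rate pX pE (memoryless_policy g)).
    by exists (memoryless_policy g) => //; apply: memoryless_policy_feasible.
  exact: leakage_rate_memoryless.
exact: leakage_rate_ge.
Qed.
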